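(* Let $A\in\mathbb{R}^{n\times n}$, let $\mathcal{U}_0=\langle0,G_0\rangle_Z\subset\mathbb{R}^n$, let $0=t_0<t_1<\dots$ with $\Delta t_k=t_{k+1}-t_k$, and let $\rho_k\ge1$ be zonotope orders. Let $\widehat{\mathcal{P}}^{\mathcal{U}}_0(t_{k+1})=\widehat{\mathcal{P}}^{\mathcal{U}}_0(t_k)\oplus e^{At_k}\Delta t_k\,\mathcal{U}_0$ with $\widehat{\mathcal{P}}^{\mathcal{U}}_0(t_0)=\{0\}$ be the particular solution computed without any reduction, and let its iteratively reduced counterpart be $\mathcal{Q}_{k+1}=\operatorname{reduce}(\mathcal{Q}_k\oplus e^{At_k}\Delta t_k\,\mathcal{U}_0,\rho_k)$ with $\mathcal{Q}_0=\{0\}$. Then the Hausdorff distance between $\widehat{\mathcal{P}}^{\mathcal{U}}_0(t_{k+1})$ and $\mathcal{Q}_{k+1}$ is bounded by $$\varepsilon^{\mathrm r}_{k+1}=\varepsilon^{\mathrm r}_k+\Delta\varepsilon^{\mathrm r}_k(\rho_k),\qquad\varepsilon^{\mathrm r}_0=0,$$ where the error $\Delta\varepsilon^{\mathrm r}_k(\rho_k)$ for one time step is given by the following bound for the zonotope $\mathcal{Z}=\mathcal{Q}_k\oplus e^{At_k}\Delta t_k\,\mathcal{U}_0$ that is reduced in step $k$: $$d_H\big(\mathcal{Z},\operatorname{reduce}(\mathcal{Z},\rho_k)\big)\le\Delta\varepsilon^{\mathrm r}_k(\rho_k):=\operatorname{err}\big(\langle0,G_{\mathrm{red}}\rangle_Z\big),$$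 with $G_{\mathrm{red}}$ the matrix formed from the generators of $\mathcal{Z}$ selected for reduction.
   Context: A zonotope is $\langle c,G\rangle_Z=\{c+\sum_{i=1}^\gamma G_{(\cdot,i)}\alpha_i:\alpha_i\in[-1,1]\}\subset\mathbb{R}^n$, its order is $\gamma/n$; $\langle c_1,G_1\rangle_Z\oplus\langle c_2,G_2\rangle_Z=\langle c_1+c_2,[G_1\ G_2]\rangle_Z$ (Minkowski sum), $M\langle c,G\rangle_Z=\langle Mc,MG\rangle_Z$. $d_H$ is the Hausdorff distance with respect to the Euclidean norm. $\operatorname{box}(\mathcal{S})$ is the tightest axis-aligned box containing $\mathcal{S}$, $\operatorname{rad}(\mathcal{S})$ the radius of the smallest ball centered at the origin containing $\mathcal{S}$, and $\operatorname{err}(\mathcal{S}):=\operatorname{rad}(\operatorname{box}(\mathcal{S}))$. Order reduction (Girard's method): for $\mathcal{Z}=\langle c,G\rangle_Z$ with $\gamma$ generators and desired order $\rho_d\ge1$, let $\pi_1,\dots,\pi_\gamma$ sort the generators so that $\|G_{(\cdot,\pi_1)}\|_1-\|G_{(\cdot,\pi_1)}\|_\infty\le\dots\le\|G_{(\cdot,\pi_\gamma)}\|_1-\|G_{(\cdot,\pi_\gamma)}\|_\infty$, let $\chi=\gamma-\lfloor(\rho_d-1)n\rfloor$ be the number of reduced generators (no generators are reduced if $\chi\le0$), $G_{\mathrm{keep}}=[G_{(\cdot,\pi_{\chi+1})}\ \dots\ G_{(\cdot,\pi_\gamma)}]$, $G_{\mathrm{red}}=\operatorname{diag}\big(\sum_{i=1}^\chi|G_{(\cdot,\pi_i)}|\big)$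 with entrywise absolute value, and $\operatorname{reduce}(\mathcal{Z},\rho_d)=\langle c,[G_{\mathrm{keep}}\ G_{\mathrm{red}}]\rangle_Z$. *)

(* Defs.v *)
From HB Require Import structures.
From mathcomp Require Import all_boot all_order all_algebra perm.
From mathcomp Require Import all_classical all_reals all_analysis.

Set Implicit Arguments.
Unset Strict Implicit.
Unset Printing Implicit Defensive.

Import Order.TTheory GRing.Theory Num.Theory.
Import numFieldNormedType.Exports.

Local Open Scope classical_set_scope.
Local Open Scope ring_scope.

Definition expmx (R : realType) (n : nat) (A : 'M[R]_n) : 'M[R]_n :=
  limn (series (fun k => (k`!%:R)^-1 *: A ^+ k)).

(* The norm `| x | that the library puts on matrices is the max norm. *)
Definition norm2 (R : realType) (n : nat) (x : 'cV[R]_n) : R :=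
  Num.sqrt (\sum_i x i 0 ^+ 2).

Definition norm1 (R : realType) (n : nat) (x : 'cV[R]_n) : R :=
  \sum_i `|x i 0|.

(* Distances and radii take values in \bar R, so that suprema and infima are
   the true ones for every set. *)
Definition hausdorff_dist (R : realType) (n : nat) (S T : set 'cV[R]_n)
    : \bar R :=
  Order.max
    (ereal_sup [set ereal_inf [set (norm2 (x - y))%:E | y in T] | x in S])
    (ereal_sup [set ereal_inf [set (norm2 (x - y))%:E | x in S] | y in T]).

Definition axis_box (R : realType) (n : nat) (l u : 'cV[R]_n)
    : set 'cV[R]_n :=
  [set x | forall i, l i 0 <= x i 0 <= u i 0].

Definition box (R : realType) (n : nat) (S : set 'cV[R]_n) : set 'cV[R]_n :=
  \bigcap_(b in [set b | S `<=` axis_box b.1 b.2]) axis_box b.1 b.2.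

Definition rad (R : realType) (n : nat) (S : set 'cV[R]_n) : \bar R :=
  ereal_inf [set r%:E | r in
    [set r : R | 0 <= r /\ S `<=` [set x | norm2 x <= r]]].

Definition err (R : realType) (n : nat) (S : set 'cV[R]_n) : \bar R :=
  rad (box S).

(* Order reduction depends on the generators and not only on the set they
   span, hence a zonotope is a representation <c, G>; the set is [zset]. *)
Record zonotope (R : realType) (n : nat) := Zonotope {
  zcount : nat;
  zcenter : 'cV[R]_n;
  zgen : 'M[R]_(n, zcount)
}.

Definition zset (R : realType) (n : nat) (Z : zonotope R n) : set 'cV[R]_n :=
  [set x | exists2 a : 'I_(zcount Z) -> R,
    (forall i, -1 <= a i <= 1) &
    x = zcenter Z + \sum_i a i *: col i (zgen Z)].

(* {0}, represented without generators *)
Definition zorigin (R : realType) (n : nat) : zonotope R n :=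
  Zonotope 0 (0 : 'M[R]_(n, 0)).

Definition zadd (R : realType) (n : nat) (Z1 Z2 : zonotope R n)
    : zonotope R n :=
  Zonotope (zcenter Z1 + zcenter Z2) (row_mx (zgen Z1) (zgen Z2)).

Definition zmap (R : realType) (n : nat) (M : 'M[R]_n) (Z : zonotope R n)
    : zonotope R n :=
  Zonotope (M *m zcenter Z) (M *m zgen Z).

(* `| g | is the max norm *)
Definition girard_weight (R : realType) (n : nat) (g : 'cV[R]_n) : R :=
  norm1 g - `|g|.

Definition sorts_generators (R : realType) (n m : nat) (G : 'M[R]_(n, m))
    (p : 'S_m) : Prop :=
  forall i j : 'I_m, (i <= j)%N ->
    girard_weight (col (p i) G) <= girard_weight (col (p j) G).

(* A choice of the sorting permutation for every generator matrix; how ties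
   are broken is left open. *)
Definition sorting_rule (R : realType) (n : nat) :=
  forall m : nat, 'M[R]_(n, m) -> 'S_m.

Definition is_sorting_rule (R : realType) (n : nat) (s : sorting_rule R n)
    : Prop :=
  forall (m : nat) (G : 'M[R]_(n, m)), sorts_generators G (s m G).

(* chi = m - floor ((rho - 1) n), replaced by 0 if negative: subtraction on
   nat truncates, and for rho >= 1 truncn is the floor. *)
Definition nb_reduced (R : realType) (n m : nat) (rho : R) : nat :=
  (m - Num.truncn ((rho - 1) * n%:R))%N.

(* The j-th kept generator has position chi + j in the sorted order. *)
Definition kept_pos (m chi : nat) (le_chi : (chi <= m)%N)
    (j : 'I_(m - chi)) : 'I_m :=
  cast_ord (subnKC le_chi) (rshift chi j).

Definition gen_keep (R : realType) (n m : nat) (G : 'M[R]_(n, m)) (p : 'S_m)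
    (rho : R) : 'M[R]_(n, m - nb_reduced n m rho) :=
  \matrix_(i, j) G i (p (kept_pos (leq_subr _ _) j)).

Definition gen_red (R : realType) (n m : nat) (G : 'M[R]_(n, m)) (p : 'S_m)
    (rho : R) : 'M[R]_n :=
  diag_mx (\row_i \sum_(j < m | (j < nb_reduced n m rho)%N) `|G i (p j)|).

Definition reduce (R : realType) (n : nat) (s : sorting_rule R n)
    (Z : zonotope R n) (rho : R) : zonotope R n :=
  if nb_reduced n (zcount Z) rho == 0%N then Z
  else let p := s _ (zgen Z) in
    Zonotope (zcenter Z) (row_mx (gen_keep (zgen Z) p rho)
                                 (gen_red (zgen Z) p rho)).

Definition reduction_error (R : realType) (n : nat) (s : sorting_rule R n)
    (Z : zonotope R n) (rho : R) : \bar R :=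
  err (zset (Zonotope 0 (gen_red (zgen Z) (s _ (zgen Z)) rho))).

(* Main.v *)
Require Import Defs.
From HB Require Import structures.
From mathcomp Require Import all_boot all_order all_algebra perm.
From mathcomp Require Import all_classical all_reals all_analysis.
From mathcomp Require Import ring lra.
Import Order.TTheory GRing.Theory Num.Theory.
Import numFieldNormedType.Exports.
Local Open Scope ring_scope.

(** Girard's method replaces the reduced generators g_j by the axis-aligned box
    with half-widths r = sum_j |g_j|.  Their own zonotope lies in that box, so
    reduction only enlarges the set.  In the other direction, a point of the
    reduced zonotope is c + kept + d with d in the box; setting the coefficients
    of the reduced generators to 0 shows that c + kept is in the original
    zonotope, at distance |d| <= |r| ([reduce_covered_within]).  The corner r is
    a point of the box, so its Euclidean norm is at most the reduction error
    ([norm2_widths_le_error]).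

    For the iteration, the unreduced set stays inside the reduced one, and each
    point of the reduced set stays within the accumulated sum of the |r| of a
    point of the unreduced one: adding the same zonotope to both sides preserves
    the two facts ([zadd_subset], [covered_within_zadd]), and a reduction adds
    its |r| by the triangle inequality ([covered_within_trans]).  Working with
    an explicit nearby point rather than with the Hausdorff distance itself
    keeps infima out of the induction. *)

(** * The Euclidean norm *)

Lemma norm2_ge0 {R : realType} {n : nat} (x : 'cV[R]_n) : 0 <= norm2 x.
Proof. exact: sqrtr_ge0. Qed.

Lemma sqr_norm2 {R : realType} {n : nat} (x : 'cV[R]_n) :
  norm2 x ^+ 2 = \sum_i x i 0 ^+ 2.
Proof. by rewrite sqr_sqrtr// sumr_ge0// => i _; exact: sqr_ge0. Qed.

Lemma norm2_eq0 {R : realType} {n : nat} (x : 'cV[R]_n) :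
  norm2 x = 0 -> x = 0.
Proof.
move=> x0; apply/colP => i; rewrite mxE; apply/eqP; rewrite -sqrf_eq0; apply/eqP.
have /psumr_eq0P : \sum_i x i 0 ^+ 2 = 0 by rewrite -sqr_norm2 x0 expr0n.
by apply=> // j _; exact: sqr_ge0.
Qed.

Lemma norm2_0 (R : realType) (n : nat) : norm2 (0 : 'cV[R]_n) = 0.
Proof. by rewrite /norm2 big1 ?sqrtr0// => i _; rewrite mxE expr0n. Qed.

Lemma norm2_le {R : realType} {n : nat} (x y : 'cV[R]_n) :
  (forall i, `|x i 0| <= y i 0) -> norm2 x <= norm2 y.
Proof.
move=> xy; apply: ler_wsqrtr; apply: ler_sum => i _.
by rewrite -[leLHS]real_normK ?num_real// lerXn2r ?nnegrE// (le_trans _ (xy i)).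
Qed.

(** Summing 0 <= (|y| x_i - |x| y_i)^2 over i gives
    2 |x| |y| (|x| |y| - x . y) >= 0. *)
Lemma cauchy_schwarz {R : realType} {n : nat} (x y : 'cV[R]_n) :
  \sum_i x i 0 * y i 0 <= norm2 x * norm2 y.
Proof.
have [x0|xN0] := eqVneq (norm2 x) 0.
  rewrite x0 mul0r big1// => i _; by rewrite (norm2_eq0 _ x0) mxE mul0r.
have [y0|yN0] := eqVneq (norm2 y) 0.
  rewrite y0 mulr0 big1// => i _; by rewrite (norm2_eq0 _ y0) mxE mulr0.
have xy_gt0 : 0 < norm2 x * norm2 y.
  by rewrite mulr_gt0// lt_neqAle eq_sym norm2_ge0 andbT.
have : 0 <= \sum_i (norm2 y * x i 0 - norm2 x * y i 0) ^+ 2.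
  by apply: sumr_ge0 => i _; exact: sqr_ge0.
have -> : \sum_i (norm2 y * x i 0 - norm2 x * y i 0) ^+ 2 =
    norm2 y ^+ 2 * (\sum_i x i 0 ^+ 2) + norm2 x ^+ 2 * (\sum_i y i 0 ^+ 2)
    - 2 * (norm2 x * norm2 y) * \sum_i x i 0 * y i 0.
  rewrite !mulr_sumr -big_split -sumrB /=; apply: eq_bigr => i _; ring.
rewrite -!sqr_norm2 => h.
by rewrite -(ler_pM2l xy_gt0); nra.
Qed.

Lemma norm2D {R : realType} {n : nat} (x y : 'cV[R]_n) :
  norm2 (x + y) <= norm2 x + norm2 y.
Proof.
rewrite -(@ler_pXn2r _ 2)// ?nnegrE ?addr_ge0 ?norm2_ge0//.
rewrite sqrrD !sqr_norm2.
have -> : \sum_i (x + y) i 0 ^+ 2 =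
    \sum_i x i 0 ^+ 2 + (\sum_i x i 0 * y i 0) *+ 2 + \sum_i y i 0 ^+ 2.
  rewrite -sumrMnl -!big_split /=; apply: eq_bigr => i _; by rewrite mxE sqrrD.
by rewrite lerD2r lerD2l lerMn2r cauchy_schwarz.
Qed.

(** * Neighbourhoods and the Hausdorff distance *)

Definition covered_within {R : realType} {n : nat} (e : R)
    (S T : set 'cV[R]_n) : Prop :=
  forall y, S y -> exists2 x, T x & norm2 (x - y) <= e.

Lemma covered_within_trans {R : realType} {n : nat} (e1 e2 : R)
    (S T U : set 'cV[R]_n) :
  covered_within e1 S T -> covered_within e2 T U ->
  covered_within (e2 + e1) S U.
Proof.
move=> ST TU y /ST[x Tx xy]; have [z Uz zx] := TU x Tx.
exists z => //; rewrite -(subrK x z) -addrA.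
by apply: le_trans (norm2D _ _) _; exact: lerD.
Qed.

(** For nested sets the inner one contributes nothing to the distance. *)
Lemma hausdorff_dist_le {R : realType} {n : nat} (e : R)
    (S T : set 'cV[R]_n) :
  0 <= e -> (S `<=` T)%classic -> covered_within e T S ->
  (hausdorff_dist S T <= e%:E)%E.
Proof.
move=> e0 ST TS; rewrite /hausdorff_dist ge_max; apply/andP; split.
  apply: ge_ereal_sup => _ [x Sx <-]; apply: (@le_trans _ _ 0%E).
    by apply: ereal_inf_lbound; exists x; [exact: ST|rewrite subrr norm2_0].
  by rewrite lee_fin.
apply: ge_ereal_sup => _ [y Ty <-]; have [x Sx xy] := TS y Ty.
apply: (@le_trans _ _ (norm2 (x - y))%:E); last by rewrite lee_fin.
by apply: ereal_inf_lbound; exists x.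
Qed.

(** * Minkowski sums of zonotopes *)

Lemma zset_row_mx {R : realType} {n m1 m2 : nat} (c1 c2 : 'cV[R]_n)
    (G1 : 'M[R]_(n, m1)) (G2 : 'M[R]_(n, m2)) (x : 'cV[R]_n) :
  zset (Zonotope (c1 + c2) (row_mx G1 G2)) x <->
  exists x1 x2,
    [/\ zset (Zonotope c1 G1) x1, zset (Zonotope c2 G2) x2 & x = x1 + x2].
Proof.
split=> [[a /= a1 ->]|[_ [_ [[a1 /= h1 ->] [a2 /= h2 ->] ->]]]].
  exists (c1 + \sum_i a (lshift m2 i) *: col i G1).
  exists (c2 + \sum_i a (rshift m1 i) *: col i G2); split.
  - by exists (fun i => a (lshift m2 i)).
  - by exists (fun i => a (rshift m1 i)).
  rewrite big_split_ord /= addrACA; congr ((_ + _) + (_ + _)).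
    by apply: eq_bigr => i _; rewrite colKl.
  by apply: eq_bigr => i _; rewrite colKr.
exists (fun i => match fintype.split i with
  inl j => a1 j | inr j => a2 j end) => /=.
  by move=> i; case: fintype.split.
rewrite big_split_ord /= addrACA; congr (_ + (_ + _)).
  by apply: eq_bigr => i _; rewrite (unsplitK (inl i)) colKl.
by apply: eq_bigr => i _; rewrite (unsplitK (inr i)) colKr.
Qed.

Lemma zset_zadd {R : realType} {n : nat} (Z1 Z2 : zonotope R n) x :
  zset (zadd Z1 Z2) x <->
  exists x1 x2, [/\ zset Z1 x1, zset Z2 x2 & x = x1 + x2].
Proof. by case: Z1 Z2 => [m1 c1 G1] [m2 c2 G2]; exact: zset_row_mx. Qed.

Lemma zadd_subset {R : realType} {n : nat} (Z1 Z2 V : zonotope R n) :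
  (zset Z1 `<=` zset Z2 -> zset (zadd Z1 V) `<=` zset (zadd Z2 V))%classic.
Proof.
move=> Z12 x /zset_zadd[y [v [Z1y Vv ->]]]; apply/zset_zadd.
by exists y, v; split=> //; exact: Z12.
Qed.

Lemma covered_within_zadd {R : realType} {n : nat} (e : R)
    (Z1 Z2 V : zonotope R n) :
  covered_within e (zset Z1) (zset Z2) ->
  covered_within e (zset (zadd Z1 V)) (zset (zadd Z2 V)).
Proof.
move=> Z12 _ /zset_zadd[y [v [Z1y Vv ->]]]; have [x Z2x xy] := Z12 y Z1y.
exists (x + v); first by apply/zset_zadd; exists x, v.
by rewrite opprD addrACA subrr addr0.
Qed.

Lemma zset_diag {R : realType} {n : nat} (r : 'rV[R]_n) (d : 'cV[R]_n) :
  (forall i, 0 <= r 0 i) ->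
  zset (Zonotope 0 (diag_mx r)) d <-> forall i, `|d i 0| <= r 0 i.
Proof.
move=> r0.
have sumE (a : 'I_n -> R) i :
    (0 + \sum_j a j *: col j (diag_mx r)) i 0 = a i * r 0 i.
  rewrite add0r summxE (bigD1 i)//= big1 ?addr0.
    by rewrite !mxE eqxx mulr1n.
  by move=> j ji; rewrite !mxE eq_sym (negbTE ji) mulr0n mulr0.
split=> [[a /= a1 ->] i|dr].
  by rewrite sumE normrM (ger0_norm (r0 i)) ler_piMl// ler_norml.
(* If r_i = 0 then d_i = 0, and the total division gives d_i / r_i = 0. *)
exists (fun i => d i 0 / r 0 i) => /= [i|].
  rewrite -ler_norml normrM normfV (ger0_norm (r0 i)).
  have [->|rN0] := eqVneq (r 0 i) 0; first by rewrite invr0 mulr0.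
  by rewrite ler_pdivrMr ?mul1r// lt_neqAle eq_sym rN0 r0.
apply/colP => i; rewrite sumE; have := dr i.
have [->|rN0 _] := eqVneq (r 0 i) 0; last by rewrite divfK.
by rewrite normr_le0 => /eqP ->; rewrite mulr0.
Qed.

(** * Order reduction *)

Lemma big_kept_pos {V : nmodType} {m chi : nat} (le_chi : (chi <= m)%N)
    (F : 'I_m -> V) :
  \sum_j F j = \sum_(j < m | (j < chi)%N) F j
             + \sum_j F (kept_pos le_chi j).
Proof.
rewrite (bigID (fun j : 'I_m => (j < chi)%N)) /=; congr (_ + _).
rewrite (reindex (cast_ord (subnKC le_chi))) /=; last first.
  by exists (cast_ord (esym (subnKC le_chi))) => j _;
    rewrite ?cast_ordK ?cast_ordKV.
rewrite big_split_ord /= big_pred0 ?add0r; last first.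
  by move=> j; rewrite ltn_ord.
by apply: eq_bigl => j; rewrite -leqNgt leq_addr.
Qed.

(** The coefficients of a point built from the kept generators alone, seen as
    coefficients for all generators in sorted order. *)
Lemma kept_extension {R : realType} {m chi : nat} (le_chi : (chi <= m)%N)
    (b : 'I_(m - chi) -> R) :
  exists2 a : 'I_m -> R, (forall j, a (kept_pos le_chi j) = b j) &
    forall j : 'I_m, (j < chi)%N -> a j = 0.
Proof.
exists (fun i => match fintype.split (cast_ord (esym (subnKC le_chi)) i) with
  inl _ => 0 | inr j => b j end) => j.
  by rewrite /kept_pos cast_ordK (unsplitK (inr j)).
by case: splitP => //= k -> /[!ltnNge]/[!leq_addr].
Qed.

Lemma kept_extension_bounded {R : realType} {m chi : nat}
    (le_chi : (chi <= m)%N) (b : 'I_(m - chi) -> R) (a : 'I_m -> R) :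
  (forall j, -1 <= b j <= 1) -> (forall j, a (kept_pos le_chi j) = b j) ->
  (forall j : 'I_m, (j < chi)%N -> a j = 0) -> forall j, -1 <= a j <= 1.
Proof.
move=> b1 ab a0 j; have [/a0 ->|chij] := ltnP j chi; first by lra.
have ltj : (j - chi < m - chi)%N by rewrite ltn_sub2r// (leq_ltn_trans chij).
suff -> : j = kept_pos le_chi (Ordinal ltj) by rewrite ab.
by apply/val_inj; rewrite /= subnKC.
Qed.

Section Girard.
Context {R : realType} {n m : nat}.
Context (c : 'cV[R]_n) (G : 'M[R]_(n, m)) (p : 'S_m) (rho : R).

Definition widths : 'cV[R]_n :=
  \col_i \sum_(j < m | (j < nb_reduced n m rho)%N) `|G i (p j)|.

Lemma widths_ge0 i : 0 <= widths i 0.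
Proof. by rewrite mxE sumr_ge0. Qed.

Lemma zset_gen_red (d : 'cV[R]_n) :
  zset (Zonotope 0 (gen_red G p rho)) d <-> forall i, `|d i 0| <= widths i 0.
Proof.
by rewrite zset_diag => [|i]; [split=> h i; move: (h i)|]; rewrite !mxE// sumr_ge0.
Qed.

(** The vector of half-widths is itself a vertex of the box, hence bounds the
    radius from below. *)
Lemma norm2_widths_le_error :
  ((norm2 widths)%:E <= err (zset (Zonotope 0 (gen_red G p rho))))%E.
Proof.
apply: le_ereal_inf_tmp => _ [r [r0 Sr] <-]; rewrite lee_fin.
apply: Sr => b Sb; apply: Sb; apply/zset_gen_red => i.
by rewrite ger0_norm// widths_ge0.
Qed.

Let le_chi : (nb_reduced n m rho <= m)%N := leq_subr _ _.

Let sum_gen (a : 'I_m -> R) :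
  \sum_j a j *: col j G =
    \sum_(j < m | (j < nb_reduced n m rho)%N) a (p j) *: col (p j) G
    + \sum_j a (p (kept_pos le_chi j)) *: col j (gen_keep G p rho).
Proof.
rewrite (reindex_inj (@perm_inj _ p)) (big_kept_pos le_chi) /=.
congr (_ + _); apply: eq_bigr => j _; congr (_ *: _).
by apply/colP => i; rewrite !mxE.
Qed.

(** The reduced generators contribute at most sum_j |a_j| |g_j| <= r in each
    coordinate, so their contribution is a point of the box. *)
Lemma girard_subset :
  (zset (Zonotope c G) `<=`
   zset (Zonotope c (row_mx (gen_keep G p rho) (gen_red G p rho))))%classic.
Proof.
move=> _ [a /= a1 ->]; rewrite -{1}[c]addr0; apply/zset_row_mx.
exists (c + \sum_j a (p (kept_pos le_chi j)) *: col j (gen_keep G p rho)).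
exists (\sum_(j < m | (j < nb_reduced n m rho)%N) a (p j) *: col (p j) G).
split; [|apply/zset_gen_red => i|by rewrite sum_gen addrAC addrA].
  by exists (fun j => a (p (kept_pos le_chi j))).
rewrite summxE mxE; apply: le_trans (ler_norm_sum _ _ _) _.
apply: ler_sum => j _; rewrite !mxE normrM ler_piMl//.
by rewrite ler_norml.
Qed.

(** A point c + kept + d of the reduced zonotope is compared with c + kept,
    which has coefficient 0 on each reduced generator. *)
Lemma girard_covered_within :
  covered_within (norm2 widths)
    (zset (Zonotope c (row_mx (gen_keep G p rho) (gen_red G p rho))))
    (zset (Zonotope c G)).
Proof.
move=> y; rewrite -{1}[c]addr0.
move=> /zset_row_mx[_ [d [[b /= b1 ->] /zset_gen_red dr ->]]].
have [a ab a0] := kept_extension le_chi b.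
exists (c + \sum_j b j *: col j (gen_keep G p rho)).
  exists (fun i => a ((p^-1)%g i)) => /= [i|].
    exact: kept_extension_bounded b1 ab a0 _.
  congr (_ + _); rewrite sum_gen [X in _ = X + _]big1 => [|j jchi].
    by rewrite add0r; apply: eq_bigr => j _; rewrite permK ab.
  by rewrite permK a0// scale0r.
rewrite opprD addrA subrr add0r; apply: norm2_le => i.
by rewrite mxE normrN.
Qed.

End Girard.

Section Reduce.
Context {R : realType} {n : nat}.
Context (s : sorting_rule R n) (Z : zonotope R n) (rho : R).

Definition widths_norm : R := norm2 (widths (zgen Z) (s _ (zgen Z)) rho).

Lemma widths_norm_le_error :
  (widths_norm%:E <= reduction_error s Z rho)%E.
Proof. exact: norm2_widths_le_error. Qed.

Lemma zset_reduce_subset : (zset Z `<=` zset (reduce s Z rho))%classic.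
Proof.
rewrite /reduce; case: ifP => _; first exact: subset_refl.
by case: Z => m c G; exact: girard_subset.
Qed.

Lemma reduce_covered_within :
  covered_within widths_norm (zset (reduce s Z rho)) (zset Z).
Proof.
rewrite /widths_norm /reduce; case: ifP => _; last first.
  by case: Z => m c G; exact: girard_covered_within.
by move=> y Zy; exists y; rewrite // subrr norm2_0 norm2_ge0.
Qed.

End Reduce.

(** * The iteration *)

Theorem proposition4 (R : realType) (n : nat) (A : 'M[R]_n)
    (m0 : nat) (G0 : 'M[R]_(n, m0))
    (t : nat -> R) (ht0 : t 0%N = 0) (ht : forall k, t k < t k.+1)
    (rho : nat -> R) (hrho : forall k, 1 <= rho k)
    (s : nat -> sorting_rule R n) (hs : forall k, is_sorting_rule (s k))
    (V P Q Z : nat -> zonotope R n) (eps : nat -> \bar R)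
    (hV : forall k,
       V k = zmap ((t k.+1 - t k) *: expmx (t k *: A)) (Zonotope 0 G0))
    (hP0 : P 0%N = zorigin R n)
    (hP : forall k, P k.+1 = zadd (P k) (V k))
    (hQ0 : Q 0%N = zorigin R n)
    (hZ : forall k, Z k = zadd (Q k) (V k))
    (hQ : forall k, Q k.+1 = reduce (s k) (Z k) (rho k))
    (heps0 : eps 0%N = 0%E)
    (heps : forall k,
       eps k.+1 = (eps k + reduction_error (s k) (Z k) (rho k))%E) :
  forall k,
    (hausdorff_dist (zset (Z k)) (zset (reduce (s k) (Z k) (rho k)))
       <= reduction_error (s k) (Z k) (rho k))%E /\
    (hausdorff_dist (zset (P k.+1)) (zset (Q k.+1)) <= eps k.+1)%E.
Proof.
have PQ k : (zset (P k) `<=` zset (Q k))%classic.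
  elim: k => [|k IH]; first by rewrite hP0 hQ0.
  rewrite hP hQ hZ; apply: subset_trans (zset_reduce_subset _ _ _).
  exact: zadd_subset.
(* The eps k are extended reals; a real lower bound of eps k is enough and
   avoids computing the radii exactly. *)
have near_eps k : exists e, [/\ 0 <= e, (e%:E <= eps k)%E
    & covered_within e (zset (Q k)) (zset (P k))].
  elim: k => [|k [e [e0 e_eps QP]]].
    exists 0; rewrite heps0 hP0 hQ0; split=> // y y0.
    by exists y; rewrite // subrr norm2_0.
  exists (e + widths_norm (s k) (Z k) (rho k)); split.
  - by rewrite addr_ge0// norm2_ge0.
  - by rewrite heps EFinD leeD// widths_norm_le_error.
  rewrite hP hQ; apply: covered_within_trans (reduce_covered_within _ _ _) _.
  by rewrite hZ; exact: covered_within_zadd.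
move=> k; split.
  apply: le_trans (widths_norm_le_error _ _ _).
  apply: hausdorff_dist_le; first exact: norm2_ge0.
    exact: zset_reduce_subset.
  exact: reduce_covered_within.
have [e [e0 e_eps QP]] := near_eps k.+1.
by apply: le_trans e_eps; exact: hausdorff_dist_le.
Qed.
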